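(* Let $s\in(0,1]$, let $I\subseteq[0,\infty)$ be an interval with interior $I^{\circ}$, let $f:I\to\mathbb{R}$ be differentiable on $I^{\circ}$, let $a,b\in I^{\circ}$ with $a<b$, and suppose $f'\in L[a,b]$. Let $\theta,\lambda\in[0,1]$ and $q\ge 1$. If $|f'|^q$ is $s$-convex on $[a,b]$, then $$\left|(1-\theta)\bigl(\lambda f(a)+(1-\lambda)f(b)\bigr)+\theta f\bigl((1-\lambda)a+\lambda b\bigr)-\frac{1}{b-a}\int_a^b f(x)\,dx\right|$$ $$\le (b-a)\,A_1(\theta)^{1-\frac1q}\Bigl\{\lambda^2\bigl[|f'(a)|^qA_2(\theta,s)+|f'(C)|^qA_3(\theta,s)\bigr]^{\frac1q}+(1-\lambda)^2\bigl[|f'(b)|^qA_2(\theta,s)+|f'(C)|^qA_3(\theta,s)\bigr]^{\frac1q}\Bigr\},$$ where $C=(1-\lambda)a+\lambda b$ and $$A_1(\theta)=\theta^2-\theta+\tfrac12,\qquad A_2(\theta,s)=\frac{2\theta^{s+2}}{(s+1)(s+2)}-\frac{\theta}{s+1}+\frac{1}{s+2},$$ $$A_3(\theta,s)=\frac{2(1-\theta)^{s+2}}{(s+1)(s+2)}-\frac{1-\theta}{s+1}+\frac{1}{s+2}.$$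
   Context: For fixed $s\in(0,1]$, a nonnegative function $g$ is $s$-convex (in the second sense) on $[a,b]\subseteq[0,\infty)$ if $g(tx+(1-t)y)\le t^s g(x)+(1-t)^s g(y)$ for all $x,y\in[a,b]$ and $t\in[0,1]$. $L[a,b]$ denotes the space of Lebesgue integrable functions on $[a,b]$. *)

(* Defs.v *)
From HB Require Import structures.
From mathcomp Require Import all_boot all_order all_algebra.
From mathcomp Require Import all_classical all_reals all_analysis.

Set Implicit Arguments.
Unset Strict Implicit.
Unset Printing Implicit Defensive.

Import Order.TTheory GRing.Theory Num.Theory.
Import numFieldNormedType.Exports.

Local Open Scope ring_scope.
Local Open Scope classical_set_scope.

(* The standing conditions 0 < s <= 1 and [a, b] `<=` [0, +oo[ are not part of
   the predicate.  As s > 0, [powR] gives 0 `^ s = 0 at t = 0 and t = 1. *)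
Definition s_convex (R : realType) (s a b : R) (g : R -> R) : Prop :=
  (forall x, x \in `[a, b] -> 0 <= g x) /\
  (forall x y t, x \in `[a, b] -> y \in `[a, b] -> t \in `[0, 1] ->
     g (t * x + (1 - t) * y) <= t `^ s * g x + (1 - t) `^ s * g y).

Definition A1 (R : realType) (theta : R) : R := theta ^+ 2 - theta + 1 / 2.

Definition A2 (R : realType) (theta s : R) : R :=
  2 * theta `^ (s + 2) / ((s + 1) * (s + 2)) - theta / (s + 1) + 1 / (s + 2).

Definition A3 (R : realType) (theta s : R) : R :=
  2 * (1 - theta) `^ (s + 2) / ((s + 1) * (s + 2))
    - (1 - theta) / (s + 1) + 1 / (s + 2).

(* Main.v *)
(* The derivative f' is never integrated.  On a segment from u to v put
   x_t = (1 - t) u + t v and p = 1 - theta, let Phi be an antiderivative of f,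
   and consider
     F t = (v - u) (t - p) f(x_t) - Phi(x_t),
     F' t = (v - u)^2 (t - p) f'(x_t),
   so that F 1 - F 0 is the quadrature error on the segment.  Young's inequality
   and s-convexity give, for every d > 0,
     |f'(x_t)| <= (1 - 1/q) d + d^(1 - q) / q * ((1 - t)^s U + t^s V)
   with U = |f'(u)|^q and V = |f'(v)|^q.  The product of |t - p| with the right
   hand side has an explicit antiderivative on each side of p, which bounds
   |F 1 - F 0| in terms of A1, A2, A3; the best d yields the power mean form.
   The theorem combines the segments [a, C] and [b, C]. *)
Require Import Defs.
From HB Require Import structures.
From mathcomp Require Import all_boot all_order all_algebra.
From mathcomp Require Import all_classical all_reals all_analysis.
From mathcomp Require Import ring.
Set Implicit Arguments.
Unset Strict Implicit.
Unset Printing Implicit Defensive.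
Import Order.TTheory GRing.Theory Num.Theory.
Import numFieldNormedType.Exports.
Local Open Scope ring_scope.
Local Open Scope classical_set_scope.

(** * Mean value inequality *)

(** The mean value theorem, applied to [G - k * F] with [k = 1] and [k = -1], gives a nonnegative
    increment in both cases. *)
Lemma norm_increment_le (R : realType) (F G dF dG : R -> R) (c d : R) :
  c <= d -> {within `[c, d], continuous F} -> {within `[c, d], continuous G} ->
  (forall t, t \in `]c, d[%R -> is_derive t 1 F (dF t)) ->
  (forall t, t \in `]c, d[%R -> is_derive t 1 G (dG t)) ->
  (forall t, t \in `]c, d[%R -> `|dF t| <= dG t) ->
  `|F d - F c| <= G d - G c.
Proof.
rewrite le_eqVlt => /predU1P[->|cd] Fc Gc F' G' FG; first by rewrite !subrr normr0.
have FGle (k : R) : `|k| = 1 -> k * (F d - F c) <= G d - G c.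
  move=> k1; pose H t := G t - k * F t.
  have Hc : {within `[c, d], continuous H}.
    move=> x; apply: cvgB; first exact: Gc.
    by apply: cvgMr; exact: Fc.
  have H' t : t \in `]c, d[%R -> is_derive t 1 H (dG t - k * dF t).
    by move=> tcd; exact: is_deriveB (G' _ tcd) (is_deriveZ k (F' _ tcd)).
  have [t tcd Ht] := MVT cd H' Hc.
  have -> : G d - G c = k * (F d - F c) + (H d - H c) by rewrite /H; ring.
  rewrite lerDl Ht mulr_ge0 ?subr_ge0 ?(ltW cd)//.
  by rewrite (le_trans _ (FG _ tcd))// (le_trans (ler_norm _))// normrM k1 mul1r.
rewrite ler_norml lerNl -mulN1r FGle ?normrN1// -[leLHS]mul1r.
by rewrite FGle ?normr1.
Qed.

(** * Antiderivatives of the weighted kernels *)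

(* [powR] is 1 at negative bases, so [fun t => t `^ r] is not continuous at 0. *)
Lemma continuous_powR_norm (R : realType) (r : R) :
  0 < r -> continuous (fun t : R => `|t| `^ r).
Proof.
move=> r0 t.
have [->|t0] := eqVneq t 0.
  rewrite /continuous_at normr0 powR0 ?gt_eqF//.
  apply/cvgrPdist_lt => e e0; near=> u.
  rewrite sub0r normrN ger0_norm ?powR_ge0//.
  have -> : e = (e `^ r^-1) `^ r by rewrite -powRrM mulVf ?gt_eqF// powRr1// ltW.
  apply: gt0_ltr_powR => //; rewrite ?nnegrE ?powR_ge0//.
  near: u; exact: (@nbhs0_lt R R) (powR_gt0 _ e0).
apply: (@continuous_comp _ _ _ (fun u : R => `|u|) (fun u => u `^ r)).
  exact: norm_continuous.
apply/differentiable_continuous/derivable1_diffP.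
by apply: derivable_powR; rewrite in_itv/= andbT normr_gt0.
Unshelve. all: by end_near. Qed.

(* An antiderivative of [fun t => (t - p) * t `^ s] on [0, +oo[. *)
Definition kernel_prim (R : realType) (s p t : R) : R :=
  t `^ (s + 2) / (s + 2) - p * t `^ (s + 1) / (s + 1).

Section kernel_prim.
Context {R : realType}.
Variables (s : R) (s0 : 0 < s).

Lemma is_derive_kernel_prim (p t : R) : 0 < t ->
  is_derive t 1 (kernel_prim s p) ((t - p) * t `^ s).
Proof.
move=> t0.
have s1 : s + 1 != 0 by rewrite gt_eqF// addr_gt0.
have s2 : s + 2 != 0 by rewrite gt_eqF// addr_gt0.
have -> : kernel_prim s p =
    fun u => (s + 2)^-1 * u `^ (s + 2) - (p / (s + 1)) * u `^ (s + 1).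
  by apply/funext => u; rewrite /kernel_prim; ring.
have dX r : is_derive t 1 (fun u => u `^ r) (r * t `^ (r - 1)).
  exact: is_derive1_powR.
apply: (is_derive_eq
  (is_deriveB (is_deriveZ (s + 2)^-1 (dX (s + 2)))
              (is_deriveZ (p / (s + 1)) (dX (s + 1))))).
rewrite /GRing.scale/=.
have -> : s + 2 - 1 = s + 1 by ring.
have -> : s + 1 - 1 = s by ring.
rewrite powRD ?(negbTE s1)// powRr1 ?ltW//; field.
by rewrite s1.
Qed.

(** The reflection [t -> 1 - t] contributes a factor -1, and -(1 - t - p) = t - (1 - p). Taking
    [p = theta] here gives the same sign change, at [1 - theta], as [kernel_prim s (1 - theta)]. *)
Lemma is_derive_kernel_prim_onem (p t : R) : t < 1 ->
  is_derive t 1 (fun u => kernel_prim s p (1 - u)) ((t - (1 - p)) * (1 - t) `^ s).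
Proof.
move=> t1.
have h1 : is_derive t 1 (cst 1 - @id R) (0 - 1) by exact: is_deriveB.
have h2 : is_derive ((cst 1 - @id R) t) 1 (kernel_prim s p)
    ((1 - t - p) * (1 - t) `^ s).
  by apply: is_derive_kernel_prim; rewrite subr_gt0.
by apply: (is_derive_eq (is_derive1_comp h2 h1)); ring.
Qed.

(** With the absolute value the function is continuous on the whole line and agrees with
    [kernel_prim s p] on [0, 1]; this settles continuity at the endpoints in the next two lemmas. *)
Lemma continuous_kernel_prim_norm p : continuous (fun t : R => kernel_prim s p `|t|).
Proof.
move=> t; apply: cvgB; apply: cvgMl; rewrite /=.
  by apply: continuous_powR_norm; rewrite addr_gt0.
by apply: cvgMr; apply: continuous_powR_norm; rewrite addr_gt0.
Qed.

Lemma within_continuous_kernel_prim p :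
  {within `[0, 1], continuous (kernel_prim s p)}.
Proof.
apply: (@subspace_eq_continuous _ _ _ (fun t : R => kernel_prim s p `|t|)).
  by move=> t; rewrite inE/= in_itv/= => /andP[t0 _]; rewrite ger0_norm.
exact/continuous_subspaceT/continuous_kernel_prim_norm.
Qed.

Lemma within_continuous_kernel_prim_onem p :
  {within `[0, 1], continuous (fun t => kernel_prim s p (1 - t))}.
Proof.
apply: (@subspace_eq_continuous _ _ _ (fun t : R => kernel_prim s p `|1 - t|)).
  by move=> t; rewrite inE/= in_itv/= => /andP[_ t1]; rewrite ger0_norm// subr_ge0.
apply: continuous_subspaceT => t.
apply: (@continuous_comp R R R (fun u => 1 - u) (fun t : R => kernel_prim s p `|t|)).
  by apply: cvgB; [exact: cvg_cst|exact: cvg_id].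
exact: continuous_kernel_prim_norm.
Qed.

(** For [p] in [0, 1] the left side is the integral of |t - p| t^s over [0, 1]: the increment on
    [p, 1] minus the increment on [0, p]. *)
Lemma kernel_prim_variationE (p : R) : 0 <= p ->
  kernel_prim s p 1 + kernel_prim s p 0 - 2 * kernel_prim s p p = A2 p s.
Proof.
move=> p0; have s1 : s + 1 != 0 by rewrite gt_eqF// addr_gt0.
have s2 : s + 2 != 0 by rewrite gt_eqF// addr_gt0.
have -> : kernel_prim s p p = - (p `^ (s + 2) / ((s + 1) * (s + 2))).
  rewrite /kernel_prim.
  have -> : p `^ (s + 2) = p * p `^ (s + 1).
    have -> : s + 1 = s + 2 - 1 by ring.
    by rewrite mulr_powRB1// addr_gt0.
  by field; rewrite s1 s2.
rewrite /kernel_prim /A2 !powR1 !powR0//.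
by field; rewrite s1 s2.
Qed.

End kernel_prim.

(** * Increment bound from a linear majorant *)

Section weighted_increment.
Context {R : realType}.
Variables (s theta U V : R) (F h : R -> R) (K : R).
Hypotheses (s0 : 0 < s) (theta01 : 0 <= theta <= 1).
Hypothesis Fc : {within `[0, 1], continuous F}.
Hypothesis F' : forall t : R, t \in `]0, 1[%R ->
  is_derive t 1 F (K * ((t - (1 - theta)) * h t)).

Lemma weighted_increment_le (al be : R) :
  (forall t : R, t \in `]0, 1[%R ->
    `|h t| <= al + be * ((1 - t) `^ s * U + t `^ s * V)) ->
  `|F 1 - F 0| <= `|K| * (al * A1 theta + be * (U * A2 theta s + V * A3 theta s)).
Proof.
move=> hle; pose p : R := 1 - theta.
have /andP[th0 th1] := theta01.
have p0 : 0 <= p by rewrite subr_ge0.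
have p1 : p <= 1 by rewrite gerBl.
(* An antiderivative of (t - p) times the majorant of |h|; the weight (1 - t)^s takes the reflected
   kernel, hence the parameter [theta] in place of [p]. *)
pose P t := al * ((t - p) ^+ 2 / 2)
  + be * (U * kernel_prim s theta (1 - t) + V * kernel_prim s p t).
have Pc : {within `[0, 1], continuous P}.
  have sqc : {within `[0, 1], continuous (fun t : R => (t - p) ^+ 2 / 2)}.
    apply: continuous_subspaceT => t; apply: cvgMl.
    by apply: cvgM; (apply: cvgB; [exact: cvg_id|exact: cvg_cst]).
  move=> t; apply: cvgD; apply: cvgMr; first exact: sqc.
  apply: cvgD; apply: cvgMr; first exact: within_continuous_kernel_prim_onem.
  exact: within_continuous_kernel_prim.
have P' (t : R) : t \in `]0, 1[%R -> is_derive t 1 P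
    ((t - p) * (al + be * ((1 - t) `^ s * U + t `^ s * V))).
  rewrite in_itv/= => /andP[t0 t1].
  have dsq : is_derive t 1 (fun u => (u - p) ^+ 2 / 2) (t - p).
    have dB : is_derive t 1 (fun u => u - p) (1 - 0) by exact: is_deriveB.
    have -> : (fun u => (u - p) ^+ 2 / 2) = fun u => 2^-1 * ((u - p) * (u - p)).
      by apply/funext => u; rewrite expr2 mulrC.
    apply: (is_derive_eq (is_deriveZ 2^-1 (is_deriveM dB dB))).
    by rewrite /GRing.scale/=; field.
  have dP := is_deriveD (is_deriveZ al dsq) (is_deriveZ be
    (is_deriveD (is_deriveZ U (is_derive_kernel_prim_onem s0 theta t1))
                (is_deriveZ V (is_derive_kernel_prim s0 p t0)))).
  apply: (is_derive_eq dP); rewrite -/p.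
  move: (_ `^ s) (_ `^ s) => w z; rewrite /GRing.scale/=. ring.
(* Here [e] is the constant sign of t - p on the piece, so [e * P] has derivative |t - p| times the
   majorant. It is used on [0, p] and [p, 1]. *)
have step (e c d : R) : 0 <= c -> c <= d -> d <= 1 ->
    `|e| = 1 -> (forall t : R, t \in `]c, d[%R -> `|t - p| = e * (t - p)) ->
    `|F d - F c| <= `|K| * (e * (P d - P c)).
  move=> c0 cd d1 e1 eP.
  have cdS : `[c, d] `<=` `[0, 1].
    by apply: subset_itv; rewrite bnd_simp.
  have cdo (t : R) : t \in `]c, d[%R -> t \in `]0, 1[%R.
    by apply: subset_itv; rewrite bnd_simp.
  pose G (t : R) : R := `|K| * (e * P t).
  pose dG (t : R) : R :=
    `|K| * (e * ((t - p) * (al + be * ((1 - t) `^ s * U + t `^ s * V)))).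
  have Gc : {within `[c, d], continuous G}.
    move=> t; apply: cvgMr; apply: cvgMr.
    exact: (continuous_subspaceW cdS Pc).
  have -> : `|K| * (e * (P d - P c)) = G d - G c by rewrite /G; ring.
  have Fcd : {within `[c, d], continuous F} by exact: continuous_subspaceW Fc.
  pose dF (t : R) : R := K * ((t - p) * h t).
  have F'cd (t : R) : t \in `]c, d[%R -> is_derive t 1 F (dF t).
    by move=> /cdo; exact: F'.
  have G'cd (t : R) : t \in `]c, d[%R -> is_derive t 1 G (dG t).
    by move=> /cdo/P' dP; exact: is_deriveZ (is_deriveZ e dP).
  have FG (t : R) : t \in `]c, d[%R -> `|dF t| <= dG t.
    move=> tcd; rewrite /dF /dG !normrM; apply: ler_wpM2l => //.
    rewrite [leRHS]mulrA -eP//; apply: ler_wpM2l => //.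
    exact/hle/cdo.
  exact: norm_increment_le cd Fcd Gc F'cd G'cd FG.
have F0p := step (-1) 0 p (lexx _) p0 p1.
have Fp1 := step 1 p 1 p0 p1 (lexx _).
have {}F0p : `|F p - F 0| <= `|K| * (P 0 - P p).
  have -> : P 0 - P p = -1 * (P p - P 0) by ring.
  apply: F0p; rewrite ?normrN1// => t.
  by rewrite in_itv/= => /andP[_ tp]; rewrite ler0_norm ?mulN1r// subr_le0 ltW.
have {}Fp1 : `|F 1 - F p| <= `|K| * (P 1 - P p).
  rewrite -[P 1 - P p]mul1r; apply: Fp1; rewrite ?normr1// => t.
  by rewrite in_itv/= => /andP[pt _]; rewrite ger0_norm ?mul1r// subr_ge0 ltW.
have -> : al * A1 theta + be * (U * A2 theta s + V * A3 theta s)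
    = (P 1 - P p) + (P 0 - P p).
  (* [A3] is [A2] at [1 - theta] by definition. The [al] term is [A1] because ((1 - p)^2 + p^2) / 2
     = theta^2 - theta + 1/2. *)
  have -> : A3 theta s = A2 p s by [].
  rewrite -(kernel_prim_variationE s0 th0) -(kernel_prim_variationE s0 p0).
  by rewrite /P /A1 subrr subr0 /p subKr; field.
rewrite mulrDr (le_trans _ (lerD Fp1 F0p))//.
by rewrite (le_trans _ (ler_normD _ _))// addrA subrK.
Qed.

End weighted_increment.

(** * Power mean bound by optimizing the linear one *)

Lemma A1_gt0 (R : realType) (theta : R) : 0 < A1 theta.
Proof.
have -> : A1 theta = (theta - 1 / 2) ^+ 2 + 1 / 4 by rewrite /A1; field.
by rewrite ltr_wpDl ?sqr_ge0.
Qed.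

(** The concave map y^(1/q) lies below its tangent at y = d^q; take y = x^q. For q > 1 this is
    Young's inequality for [x / d] and 1; at [q = 1] there is no finite conjugate exponent, hence
    the case split. *)
Lemma powR_tangent_le (R : realType) (q d x : R) : 1 <= q -> 0 < d -> 0 <= x ->
  x <= (1 - 1 / q) * d + 1 / q * d `^ (1 - q) * x `^ q.
Proof.
move=> q1 d0 x0; have [->|qn1] := eqVneq q 1.
  by rewrite divr1 subrr mul0r add0r powRr0 powRr1// !mul1r.
have {q1}qn1 : 1 < q by rewrite lt_neqAle eq_sym qn1.
have q0 : 0 < q by apply: lt_trans qn1.
have qB : q - 1 != 0 by rewrite subr_eq0 gt_eqF.
have qB0 : 0 < q / (q - 1) by rewrite divr_gt0// subr_gt0.
have qV : q^-1 + (q / (q - 1))^-1 = 1.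
  by field; rewrite qB gt_eqF.
have := conjugate_powR (divr_ge0 x0 (ltW d0)) ler01 q0 qB0 qV.
rewrite powR1 mulr1 ler_pdivrMr// => /le_trans; apply.
have dV : d^-1 `^ q = d `^ (- q).
  by rewrite -powR_inv1 ?(ltW d0)// -powRrM mulN1r.
rewrite powRM ?invr_ge0 ?(ltW d0)// dV.
rewrite powRD ?(gt_eqF d0) ?implybT// powRr1 ?(ltW d0)//.
by rewrite le_eqVlt; apply/orP; left; apply/eqP; field; rewrite qB gt_eqF.
Qed.

Lemma power_mean_increment_le (R : realType) (s theta U V q K : R) (F h : R -> R) :
  0 < s -> 0 <= theta <= 1 -> 1 <= q ->
  {within `[0, 1], continuous F} ->
  (forall t : R, t \in `]0, 1[%R ->
    is_derive t 1 F (K * ((t - (1 - theta)) * h t))) ->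
  (forall t : R, t \in `]0, 1[%R ->
    `|h t| `^ q <= (1 - t) `^ s * U + t `^ s * V) ->
  `|F 1 - F 0| <= `|K| * (A1 theta `^ (1 - 1 / q)
                   * (U * A2 theta s + V * A3 theta s) `^ (1 / q)).
Proof.
move=> s0 theta01 q1 Fc F' hq.
have q0 : 0 < q by apply: lt_le_trans q1.
set S := U * A2 theta s + V * A3 theta s.
have A0 := A1_gt0 theta.
have bound (d : R) : 0 < d ->
    `|F 1 - F 0| <= `|K| * ((1 - 1 / q) * d * A1 theta + 1 / q * d `^ (1 - q) * S).
  move=> d0; apply: (weighted_increment_le s0 theta01 Fc F') => t t01.
  apply: le_trans (powR_tangent_le q1 d0 (normr_ge0 _)) _.
  by rewrite lerD2l ler_wpM2l ?hq// mulr_ge0 ?powR_ge0// divr_ge0// ltW.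
(* The linear bound for the zero function says that S is nonnegative. *)
have S0 : 0 <= S.
  have c0 : {within `[0, 1], continuous (cst 0 : R -> R)}.
    by apply: continuous_subspaceT => t; exact: cvg_cst.
  have d0 (t : R) : t \in `]0, 1[%R ->
      is_derive t 1 (cst 0 : R -> R) (1 * ((t - (1 - theta)) * (cst 0 t))).
    by move=> _; rewrite mulr0 mulr0; exact: is_derive_cst.
  have m0 (t : R) : t \in `]0, 1[%R ->
      `|cst 0 t : R| <= 0 + 1 * ((1 - t) `^ s * U + t `^ s * V).
    by move=> /hq; rewrite normr0 add0r mul1r; apply: le_trans; exact: powR_ge0.
  have := weighted_increment_le s0 theta01 c0 d0 m0.
  by rewrite subrr normr0 normr1 mul0r add0r !mul1r.
(* For [S = 0] the optimal [d] can degenerate to 0, which [bound] excludes, so [d] is taken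
   arbitrarily small; the denominator [c + 1] covers [c = 0]. *)
have [S00|Sn0] := eqVneq S 0.
  rewrite S00 powR0 ?mulr0; last by rewrite mul1r invr_eq0 gt_eqF.
  apply/ler_addgt0Pr => e e0; rewrite add0r.
  have c0 : 0 <= `|K| * ((1 - 1 / q) * A1 theta).
    rewrite mulr_ge0// mulr_ge0 ?(ltW A0)// subr_ge0 ler_pdivrMr// mul1r//.
  set c := `|K| * _ in c0.
  have c1 : 0 < c + 1 by rewrite ltr_wpDl.
  apply: le_trans (bound (e / (c + 1)) _) _; first by rewrite divr_gt0.
  rewrite S00 mulr0 addr0.
  have -> : `|K| * ((1 - 1 / q) * (e / (c + 1)) * A1 theta) = c * e / (c + 1).
    by rewrite /c; ring.
  by rewrite ler_pdivrMr// mulrC ler_wpM2l ?(ltW e0)// lerDl.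
have {Sn0}S0 : 0 < S by rewrite lt_neqAle eq_sym Sn0.
have SA0 : 0 < S / A1 theta by rewrite divr_gt0.
(* For q > 1 the right side of [bound] is minimal in [d] where d^q = S / A1; its two terms then add
   up to d * A1. *)
have d0 : 0 < (S / A1 theta) `^ (1 / q) by rewrite powR_gt0.
apply: le_trans (bound _ d0) _; apply: ler_wpM2l => //.
set d := (S / A1 theta) `^ (1 / q) in d0 *.
have -> : S `^ (1 / q) = d * A1 theta `^ (1 / q).
  by rewrite -powRM ?(ltW A0) ?(ltW SA0)// divfK// gt_eqF.
have -> : A1 theta `^ (1 - 1 / q) * (d * A1 theta `^ (1 / q)) = d * A1 theta.
  by rewrite mulrCA -powRD ?(gt_eqF A0) ?implybT// subrK powRr1// ltW.
have dq : d `^ q = S / A1 theta.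
  by rewrite -powRrM divfK ?gt_eqF// powRr1// ltW.
rewrite powRB ?(gt_eqF d0) ?implybT// powRr1 ?(ltW d0)// dq.
by rewrite le_eqVlt; apply/orP; left; apply/eqP; field; rewrite !gt_eqF.
Qed.

(** * Quadrature error on one segment *)

Section segment.
Context {R : realType}.
Variables (s theta U V q u v : R) (f df Phi : R -> R).
Hypotheses (s0 : 0 < s) (theta01 : 0 <= theta <= 1) (q1 : 1 <= q).
Let x (t : R) : R := (1 - t) * u + t * v.
Hypothesis f' : forall t : R, t \in `[0, 1]%R -> is_derive (x t) 1 f (df (x t)).
Hypothesis Phi' : forall t : R, t \in `[0, 1]%R -> is_derive (x t) 1 Phi (f (x t)).
Hypothesis dfq : forall t : R, t \in `[0, 1]%R ->
  `|df (x t)| `^ q <= (1 - t) `^ s * U + t `^ s * V.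

(** This is the power mean bound with K = (v - u)^2. Both orders of [u] and [v] are covered, so the
    segment can run from [b] down to [C]. *)
Lemma segment_quadrature_error_le :
  `|(v - u) * (theta * f v + (1 - theta) * f u) - (Phi v - Phi u)| <=
  (v - u) ^+ 2 * (A1 theta `^ (1 - 1 / q)
                  * (U * A2 theta s + V * A3 theta s) `^ (1 / q)).
Proof.
pose p : R := 1 - theta.
pose F (t : R) : R := (v - u) * ((t - p) * f (x t)) - Phi (x t).
have dF (t : R) : t \in `[0, 1]%R ->
    is_derive t 1 F ((v - u) ^+ 2 * ((t - p) * df (x t))).
  move=> t01.
  have dx : is_derive t 1 x (v - u).
    have -> : x = fun t => u + (v - u) * t.
      by apply/funext => w; rewrite /x; ring.
    apply: (is_derive_eq (is_deriveD (is_derive_cst u t 1)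
      (is_deriveZ (v - u) (is_derive_id t 1)))).
    by rewrite add0r /GRing.scale/= mulr1.
  have dB : is_derive t 1 (fun w => w - p) (1 - 0) by exact: is_deriveB.
  apply: (is_derive_eq (is_deriveB
    (is_deriveZ (v - u) (is_deriveM dB (is_derive1_comp (f' t01) dx)))
    (is_derive1_comp (Phi' t01) dx))).
  by rewrite /GRing.scale/=; ring.
have Fc : {within `[0, 1], continuous F}.
  by apply: derivable_within_continuous => t /dF[].
have oc (t : R) : t \in `]0, 1[%R -> t \in `[0, 1]%R.
  exact: subset_itv_oo_cc.
have := power_mean_increment_le s0 theta01 q1 Fc
  (fun t t01 => dF t (oc t t01)) (fun t t01 => dfq (oc t t01)).
rewrite (ger0_norm (sqr_ge0 (v - u))).
suff -> : F 1 - F 0 = (v - u) * (theta * f v + (1 - theta) * f u) - (Phi v - Phi u).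
  by [].
have x1 : x 1 = v by rewrite /x; ring.
have x0 : x 0 = u by rewrite /x; ring.
by rewrite /F x1 x0 /p; ring.
Qed.

End segment.

(** * Antiderivative of f and room around [a, b] *)

Lemma continuous_antiderivative (R : realType) (f : R -> R) (a b : R) :
  a < b -> {within `[a, b], continuous f} ->
  (forall x, x \in `]a, b[%R -> {for x, continuous f}) ->
  exists Phi : R -> R,
    (forall x, x \in `]a, b[%R -> is_derive x 1 Phi (f x)) /\
    (forall c d, c \in `]a, b[%R -> d \in `]a, b[%R -> c <= d ->
      \int[@lebesgue_measure R]_(x in `[c, d]) f x = Phi d - Phi c).
Proof.
move=> ab fc fx.
have fi : (@lebesgue_measure R).-integrable `[a, b] (EFin \o f).
  by apply: continuous_compact_integrable => //; exact: segment_compact.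
exists (fun x => \int[@lebesgue_measure R]_(t in `[a, x]) f t); split.
- move=> x xab; have := xab; rewrite in_itv/= => /andP[ax xb].
  have [dPhi Phi'] := continuous_FTC1_closed xb fi ax (fx _ xab).
  by apply: DeriveDef => //; rewrite -derive1E.
- move=> c d; rewrite !in_itv/= => /andP[ac cb] /andP[ad db] cd.
  (* The difference of the two integrals is an integral over ]c, d]; adding the null point [c]
     closes the interval. *)
  rewrite Rintegral_itvB ?bnd_simp ?(ltW ac)//; last first.
    by apply: integrableS fi => //; apply: subset_itv; rewrite bnd_simp// ltW.
  rewrite Rintegral_itv_obnd_cbnd//; apply: integrableS fi => //.
  by apply: subset_itv; rewrite bnd_simp// ltW.
Qed.

(** Enlarging [a, b] makes [a] and [b] interior points of [c, d], where the antiderivative is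
    differentiable. *)
Lemma interior_interval_between (R : realType) (I : set R) (a b : R) :
  is_interval I -> I° a -> I° b -> a < b ->
  exists c d, [/\ c < a, b < d & forall x, x \in `[c, d]%R -> I° x].
Proof.
move=> II Ia Ib ab.
have /nbhs_ballP[e /= e0 ea] := open_nbhs_nbhs (conj (open_interior I) Ia).
have /nbhs_ballP[r /= r0 rb] := open_nbhs_nbhs (conj (open_interior I) Ib).
have Ic : I° (a - e / 2).
  apply: ea; rewrite /ball/= opprB addrC subrK gtr0_norm ?divr_gt0//.
  by rewrite ltr_pdivrMr// ltr_pMr// ltr1n.
have Id : I° (b + r / 2).
  apply: rb; rewrite /ball/= opprD addrA subrr sub0r normrN gtr0_norm ?divr_gt0//.
  by rewrite ltr_pdivrMr// ltr_pMr// ltr1n.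
exists (a - e / 2), (b + r / 2); split.
- by rewrite ltrBlDr ltrDl divr_gt0.
- by rewrite ltrDl divr_gt0.
- move=> x; rewrite in_itv/= !le_eqVlt => /andP[/predU1P[<-//|cx] /predU1P[->//|xd]].
  (* Being an interval only puts the points between in [I]; since these form an open set, they lie
     in its interior. *)
  have oS : `]a - e / 2, b + r / 2[ `<=` I.
    move=> y /=; rewrite in_itv/= => /andP[cy yd].
    apply: (II _ _ (interior_subset Ic) (interior_subset Id)).
    by rewrite !ltW.
  have oo : open (`]a - e / 2, b + r / 2[ : set R) by exact: interval_open.
  by move: oS; rewrite (open_subsetE _ oo); apply; rewrite /= in_itv/= cx.
Qed.

(** * Combination of the two segments *)

Theorem theorem2 (R : realType) (s : R) (I : set R) (f : R -> R)
    (a b theta lambda q : R)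
    (hs : 0 < s <= 1)
    (hI : is_interval I)
    (hI0 : I `<=` [set x | 0 <= x])
    (hf : forall x : R, I° x -> derivable f x 1)
    (ha : I° a) (hb : I° b) (hab : a < b)
    (hf' : (@lebesgue_measure R).-integrable `[a, b] (EFin \o f^`()))
    (htheta : 0 <= theta <= 1) (hlambda : 0 <= lambda <= 1) (hq : 1 <= q)
    (hconv : s_convex s a b (fun x => `|f^`() x| `^ q)) :
  let C := (1 - lambda) * a + lambda * b in
  `| (1 - theta) * (lambda * f a + (1 - lambda) * f b) + theta * f C
     - 1 / (b - a) * \int[@lebesgue_measure R]_(x in `[a, b]) f x |
  <= (b - a) * A1 theta `^ (1 - 1 / q) *
     (lambda ^+ 2 *
        (`|f^`() a| `^ q * A2 theta s + `|f^`() C| `^ q * A3 theta s) `^ (1 / q)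
      + (1 - lambda) ^+ 2 *
        (`|f^`() b| `^ q * A2 theta s + `|f^`() C| `^ q * A3 theta s) `^ (1 / q)).
cbv zeta; set C := (1 - lambda) * a + lambda * b.
have /andP[s0 _] := hs.
have [c [d [ca bd cdI]]] := interior_interval_between hI ha hb hab.
have df x : x \in `[c, d]%R -> is_derive x 1 f (f^`() x).
  by move=> /cdI Ix; apply: DeriveDef; [exact: hf|rewrite derive1E].
have fx x : x \in `[c, d]%R -> {for x, continuous f}.
  move=> /cdI/hf dfx; exact/differentiable_continuous/derivable1_diffP.
have cd : c < d by rewrite (lt_trans ca)// (lt_trans hab).
have fc : {within `[c, d], continuous f}.
  by apply: derivable_within_continuous => t /df[].
have oc (x : R) : x \in `]c, d[%R -> x \in `[c, d]%R.
  exact: subset_itv_oo_cc.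
have [Phi [Phi' Phiint]] := continuous_antiderivative cd fc (fun x xcd => fx x (oc x xcd)).
have abo (x : R) : x \in `[a, b]%R -> x \in `]c, d[%R.
  by rewrite !in_itv/= => /andP[ax xb]; rewrite (lt_le_trans ca)// (le_lt_trans xb).
have aab : a \in `[a, b]%R by rewrite in_itv/= lexx ltW.
have bab : b \in `[a, b]%R by rewrite in_itv/= lexx ltW.
have conv01 (u v t : R) : u \in `[a, b]%R -> v \in `[a, b]%R -> t \in `[0, 1]%R ->
    (1 - t) * u + t * v \in `[a, b]%R.
  rewrite !in_itv/= => /andP[au ub] /andP[av vb] /andP[t0 t1].
  have t1' : 0 <= 1 - t by rewrite subr_ge0.
  have -> : a = (1 - t) * a + t * a by ring.
  have -> : b = (1 - t) * b + t * b by ring.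
  by rewrite !lerD// ler_wpM2l.
have Cab : C \in `[a, b]%R by apply: conv01.
have segment (u v : R) : u \in `[a, b]%R -> v \in `[a, b]%R ->
    `|(v - u) * (theta * f v + (1 - theta) * f u) - (Phi v - Phi u)| <=
    (v - u) ^+ 2 * (A1 theta `^ (1 - 1 / q) *
      (`|f^`() u| `^ q * A2 theta s + `|f^`() v| `^ q * A3 theta s) `^ (1 / q)).
  move=> uab vab.
  have df01 (t : R) : t \in `[0, 1]%R ->
      is_derive ((1 - t) * u + t * v) 1 f (f^`() ((1 - t) * u + t * v)).
    by move=> t01; exact/df/oc/abo/conv01.
  have Phi01 (t : R) : t \in `[0, 1]%R ->
      is_derive ((1 - t) * u + t * v) 1 Phi (f ((1 - t) * u + t * v)).
    by move=> t01; exact/Phi'/abo/conv01.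
  have dfq (t : R) : t \in `[0, 1]%R -> `|f^`() ((1 - t) * u + t * v)| `^ q <=
      (1 - t) `^ s * `|f^`() u| `^ q + t `^ s * `|f^`() v| `^ q.
    (* Convexity is applied with weight [1 - t] on [u], matching the parametrization from [u] to
       [v]. *)
    move=> t01; have := hconv.2 u v (1 - t).
    rewrite subKr; apply; rewrite inE//=.
    by move: t01; rewrite !in_itv/= => /andP[t0 t1]; rewrite subr_ge0 t1 gerBl.
  exact: segment_quadrature_error_le s0 htheta hq df01 Phi01 dfq.
have ba0 : 0 < b - a by rewrite subr_gt0.
rewrite (Phiint a b (abo _ aab) (abo _ bab) (ltW hab)).
move: (segment a C aab Cab) (segment b C bab Cab).
move: (A1 theta) (A2 theta s) (A3 theta s) => m1 m2 m3.
move: (1 / q) => r.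
move: (`|f^`() a| `^ q) (`|f^`() b| `^ q) (`|f^`() C| `^ q) => ga gb gC.
move: (m1 `^ (1 - r)) ((ga * m2 + gC * m3) `^ r) ((gb * m2 + gC * m3) `^ r).
move=> X Y Z La Lb.
have Ca : C - a = lambda * (b - a) by rewrite /C; ring.
have Cb : C - b = - ((1 - lambda) * (b - a)) by rewrite /C; ring.
set T := (X in `|X|).
(* In the difference of the two segment errors [Phi C] cancels, and the values of [f] get weights
   [lambda] and [1 - lambda] from C - a and C - b. The squares of these lengths give the
   coefficients of the bound. *)
have -> : T = (((C - a) * (theta * f C + (1 - theta) * f a) - (Phi C - Phi a))
  - ((C - b) * (theta * f C + (1 - theta) * f b) - (Phi C - Phi b))) / (b - a).
  by rewrite /T Ca Cb; field; rewrite gt_eqF.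
rewrite normrM normfV (gtr0_norm ba0) ler_pdivrMr//.
apply: le_trans (ler_normB _ _) _; apply: le_trans (lerD La Lb) _.
rewrite Ca Cb le_eqVlt; apply/orP; left; apply/eqP; ring.
Qed.
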